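(* Let $k,n>0$, $\tau>0$, $C_{max}>C_{min}>0$, $v_{max}>v_{min}>0$, $L\in[v_{min}\tau,v_{max}\tau]$, $\overline{C}\in[C_{min},C_{max}]$, $\overline{v}\in[v_{min},v_{max}]$, and let $(C_{A_0},v)\in\mathcal{V}_\tau$. Then the cost functional $J[C_{A_0},v]=\frac1\tau\int_0^\tau C_A(L,t)\,v(t)\,dt$ can be rewritten as follows: $$J[C_{A_0},v]=\frac1\tau\int_0^\tau C_{A_0}(t)e^{-k\tau}v(t)\,dt\quad\text{if } n=1,$$ $$J[C_{A_0},v]=\frac1\tau\int_0^\tau\Psi(C_{A_0}(t))\,v(t)\,dt\quad\text{if } n\neq1,$$ where $\Psi(\xi):=\left(\xi^{-(n-1)}+k(n-1)\tau\right)^{-\frac{1}{n-1}}$ is an increasing concave function in the case $n>1$.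
   Context: The class $\mathcal{V}_\tau$ consists of all locally measurable $\tau$-periodic vector-functions $(c,v):\mathbb{R}\to[C_{min},C_{max}]\times[v_{min},v_{max}]$ with $\frac1\tau\int_0^\tau c(t)v(t)\,dt=\overline{C}\,\overline{v}$ and $\int_0^\tau v(t)\,dt=L$. Model: $\frac{\partial C_A}{\partial t}+v(t)\frac{\partial C_A}{\partial x}+kC_A^n=0$ on $[0,L]\times\mathbb{R}$, $C_A(0,t)=C_{A_0}(t)$. Let $V(t)=\int_0^t v(\xi)\,d\xi$ ($t\in\mathbb{R}$), a strictly increasing function with inverse $V^{-1}$. The (weak) solution $C_A$ corresponding to $(C_{A_0},v)$ is given by the method of characteristics as $$C_A(x,t)=\left[C_{A_0}(r)^{-(n-1)}+k(n-1)(t-r)\right]^{-\frac{1}{n-1}}\ (n\ne1),\qquad C_A(x,t)=C_{A_0}(r)\,e^{-k(t-r)}\ (n=1),$$ where $r=V^{-1}(V(t)-x)$. *)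

(* Defs.v *)
From HB Require Import structures.
From mathcomp Require Import all_boot all_order all_algebra.
From mathcomp Require Import all_classical all_reals all_analysis.

Set Implicit Arguments.
Unset Strict Implicit.
Unset Printing Implicit Defensive.
Import Order.TTheory GRing.Theory Num.Theory.
Import numFieldNormedType.Exports.
Local Open Scope classical_set_scope.
Local Open Scope ring_scope.

(* The real line with the sigma-algebra of Lebesgue-measurable sets (the
   Caratheodory sets of the Lebesgue outer measure), as opposed to the Borel
   sigma-algebra that is canonical on R. *)
Definition lebesgueType (R : realType) :=
  caratheodory_type ((@wlength R idfun)^*)%mu.

Definition locally_measurable (R : realType) (f : R -> R) : Prop :=
  forall a b : R, measurable_fun (`[a, b] : set (lebesgueType R)) f.

Definition lebesgue_integral (R : realType) (a b : R) (f : R -> R) : R :=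
  Rintegral (@completed_lebesgue_measure R) `[a, b] f.

(* \int_0^t f, with the usual sign convention when t < 0. *)
Definition primitive0 (R : realType) (f : R -> R) (t : R) : R :=
  if 0 <= t then lebesgue_integral 0 t f else - lebesgue_integral t 0 f.

Record admissible (R : realType) (tau Cmin Cmax vmin vmax L Cbar vbar : R)
    (c v : R -> R) : Prop := Admissible {
  adm_meas_c : locally_measurable c ;
  adm_meas_v : locally_measurable v ;
  adm_per_c : periodic c tau ;
  adm_per_v : periodic v tau ;
  adm_range_c : forall t, Cmin <= c t <= Cmax ;
  adm_range_v : forall t, vmin <= v t <= vmax ;
  adm_mean : tau^-1 * lebesgue_integral 0 tau (fun t => c t * v t)
             = Cbar * vbar ;
  adm_flow : lebesgue_integral 0 tau v = L }.

(* r = V^-1 (V t - x), the time at which the characteristic through (x, t)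
   leaves x = 0; pinv is the two-sided inverse since V is a bijection of R
   for the velocities considered. *)
Definition entry_time (R : realType) (v : R -> R) (x t : R) : R :=
  let V := primitive0 v in 'pinv_(fun=> 0) setT V (V t - x).

(* For n < 1 the base of the outer power may be negative, and the formula then
   has no real meaning; powR returns 1 there. For n > 1 and positive inlet
   concentrations the base is positive as soon as r <= t. *)
Definition C_A (R : realType) (k n : R) (cA0 v : R -> R) (x t : R) : R :=
  let r := entry_time v x t in
  if n == 1 then cA0 r * expR (- k * (t - r))
  else (cA0 r `^ (- (n - 1)) + k * (n - 1) * (t - r)) `^ (- (n - 1)^-1).

Definition cost (R : realType) (k n tau L : R) (cA0 v : R -> R) : R :=
  tau^-1 * lebesgue_integral 0 tau (fun t => C_A k n cA0 v L t * v t).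

Definition Psi (R : realType) (k n tau xi : R) : R :=
  (xi `^ (- (n - 1)) + k * (n - 1) * tau) `^ (- (n - 1)^-1).

Definition concave_function (R : realType) (D : set R) (f : R -> R) : Prop :=
  @convex_function R R^o D (fun x => - f x).

(* Main.v *)
(** Since v is tau-periodic with integral L over a period, its primitive V
satisfies V (t - tau) = V t - L, and V is injective because v is bounded below
by a positive constant.  Hence every characteristic reaching the outlet x = L
at time t entered at time t - tau, the residence time is the constant tau, and
periodicity of the inlet concentration makes the two integrands equal
pointwise.  For m = n - 1 > 0 and K = k m tau, Psi has the derivative
(1 + K x^m)^(-1/m - 1), which is positive and decreasing. *)

Require Import Defs.
From mathcomp Require Import all_boot all_order all_algebra.
From mathcomp Require Import all_classical all_reals all_analysis.
From mathcomp Require Import measurable_realfun ring.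

Set Implicit Arguments.
Unset Strict Implicit.
Unset Printing Implicit Defensive.
Import Order.TTheory GRing.Theory Num.Theory.
Import numFieldNormedType.Exports.
Local Open Scope classical_set_scope.
Local Open Scope ring_scope.

(** * Translation invariance of the completed Lebesgue measure and its integral *)

Lemma preimage_shift_oc (R : realType) (c a b : R) :
  +%R^~ c @^-1` `]a, b]%classic = `]a - c, b - c]%classic.
Proof. by apply/seteqP; split=> x; rewrite /= !in_itv/= ltrBlDr lerBrDr. Qed.

(** Translating a cover by half-open intervals keeps its total length, which gives one inequality
    for every shift; the shift by [- c] gives the other. *)
Lemma wlength_outer_shift (R : realType) (c : R) (A : set R) :
  ((@wlength R idfun)^*)%mu (+%R^~ c @^-1` A) = ((@wlength R idfun)^*)%mu A.
Proof.
have shift_le d B :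
    (((@wlength R idfun)^*)%mu (+%R^~ d @^-1` B) <= ((@wlength R idfun)^*)%mu B)%E.
  apply: le_ereal_inf_tmp => _ [F [mF BF] <-].
  apply: ereal_inf_lbound; exists (fun k => +%R^~ d @^-1` F k).
    split=> [i|x /BF [k _ Fkx]]; last by exists k.
    have [[a b] _ <-] := mF i.
    by rewrite preimage_shift_oc; exists (a - d, b - d).
  apply: eq_eseriesr => i _; have [[a b] _ <-] := mF i.
  rewrite preimage_shift_oc !wlength_itv /= !lte_fin ltrD2r.
  by case: ifP => // _; rewrite -!EFinB; congr EFin; ring.
apply/eqP; rewrite eq_le shift_le /=.
apply: le_trans (shift_le (- c) _).
by apply: le_mu_ext => x Ax /=; rewrite addrNK.
Qed.

(** The sigma-algebra is that of Caratheodory sets, so measurability is checked on the splitting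
    condition itself, which invariance of the outer measure transports. *)
Lemma measurable_shift (R : realType) (c : R) :
  measurable_fun setT (+%R^~ c : lebesgueType R -> lebesgueType R).
Proof.
move=> _ A mA; rewrite setTI.
pose nu (B : set R) : \bar R := ((@wlength R idfun)^*)%mu B.
have nuS d (B : set R) : nu (+%R^~ d @^-1` B) = nu B := wlength_outer_shift d B.
have nuA (X : set R) : nu X = (nu (X `&` A) + nu (X `&` ~` A))%E := mA X.
change (forall X : set R, nu X = (nu (X `&` (+%R^~ c @^-1` A)) +
  nu (X `&` ~` (+%R^~ c @^-1` A)))%E) => X.
(* The test set is translated, split along [A], and both pieces are translated back. *)
rewrite -(nuS (- c) X) nuA -(nuS c (_ `&` A)) -(nuS c (_ `&` ~` A)).
by congr (nu _ + nu _)%E; apply/seteqP; split=> x /=; rewrite addrK.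
Qed.

Lemma measurable_lebesgueType_itv (R : realType) (i : interval R) :
  measurable ([set` i] : set (lebesgueType R)).
Proof. by apply: sub_caratheodory; exact: measurable_itv. Qed.

(** Change of variables along the translation: by invariance the pushforward is the measure itself.
    With a nonnegative integrand, measurability is enough to apply it. *)
Lemma lebesgue_integral_shift (R : realType) (a b c : R) (f : R -> R) :
  locally_measurable f -> (forall x, 0 <= f x) ->
  lebesgue_integral a b (fun x => f (x + c)) =
  lebesgue_integral (a + c) (b + c) f.
Proof.
move=> mf f0; rewrite /lebesgue_integral /Rintegral; congr fine.
pose D : set (lebesgueType R) := `[a + c, b + c]%classic.
have mD : measurable D := measurable_lebesgueType_itv _.
pose phi : lebesgueType R -> lebesgueType R := +%R^~ c.
have mphi : measurable_fun setT phi := measurable_shift c.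
transitivity (\int[pushforward (@completed_lebesgue_measure R) phi]_(x in D) (f x)%:E)%E; last first.
  by apply: eq_measure_integral => A mA _; exact: wlength_outer_shift.
have phiD : phi @^-1` D = `[a, b]%classic.
  by apply/seteqP; split=> x; rewrite /D /phi /= !in_itv/= !lerD2r.
rewrite (ge0_integral_pushforward mphi _ mD).
- by rewrite phiD.
- by apply/measurable_EFinP; exact: mf.
- by move=> x _; rewrite lee_fin.
Qed.

(** * Bounded measurable functions on compact intervals *)

Section lebesgue_itv.
Context {R : realType}.

Lemma completed_lebesgue_measure_itv (a b : R) : a <= b ->
  completed_lebesgue_measure `[a, b] = (b - a)%:E.
Proof.
(* Both measures are restrictions of the same outer measure. *)
move=> ab; transitivity (@lebesgue_measure R `[a, b]) => //.
rewrite lebesgue_measure_itv /= lte_fin EFinB.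
by case: ltgtP ab => // -> _; rewrite subee.
Qed.

Lemma bounded_integrable_itv (a b : R) (f : R -> R) (M : R) :
  locally_measurable f -> (forall x, `|f x| <= M) ->
  (@completed_lebesgue_measure R).-integrable `[a, b] (EFin \o f).
Proof.
move=> mf fM; have [ab|ba] := leP a b; last first.
  by rewrite set_itv_ge -?ltNge ?bnd_simp //; exact: integrable_set0.
apply: measurable_bounded_integrable.
- exact: measurable_lebesgueType_itv.
- by rewrite [X in (X < _)%E](completed_lebesgue_measure_itv ab) ltry.
- exact: mf.
- exists M; split; first exact: num_real.
  by move=> N MN x _; apply: le_trans (fM x) (ltW MN).
Qed.

End lebesgue_itv.

(** * The primitive of a periodic velocity and the entry time *)

Section bounded_integrand.
Variables (R : realType) (f : R -> R) (M : R).
Hypotheses (mf : locally_measurable f) (f_le : forall x, `|f x| <= M).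

Let integrable_itv (a b : R) :
  (@completed_lebesgue_measure R).-integrable `[a, b] (EFin \o f).
Proof. exact: bounded_integrable_itv mf f_le. Qed.

Lemma lebesgue_integralD (a b c : R) : a <= b -> b <= c ->
  lebesgue_integral a c f =
  lebesgue_integral a b f + lebesgue_integral b c f.
Proof.
move=> ab bc; rewrite /lebesgue_integral.
have eI : `[a, c]%classic = `[a, b]%classic `|` `]b, c]%classic.
  by apply: itv_bndbnd_setU; rewrite bnd_simp.
rewrite eI Rintegral_setU.
- congr (_ + _); rewrite /Rintegral; congr fine.
  have b0 := etrans (completed_lebesgue_measure_itv (lexx b)) (congr1 EFin (subrr b)).
  have mi := @measurable_lebesgueType_itv R.
  (* The closed intervals share the point [b], a null set that can be removed from the second
     one. *)
  rewrite (negligible_integral (mi `[b, b]) (mi `[b, c]) (integrable_itv b c) b0).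
  suff -> : `[b, c] `\` `[b, b] = `]b, c]%classic by [].
  apply/seteqP; split=> x; rewrite /= !in_itv/=; last first.
    by move=> /andP[bx ->]; rewrite (ltW bx) leNgt bx andbF.
  by case=> /andP[bx ->]; rewrite bx /= => /negP; rewrite -ltNge andbT.
- exact: measurable_lebesgueType_itv.
- exact: measurable_lebesgueType_itv.
- by rewrite -eI; exact: integrable_itv.
- apply/disj_setPS => y [/=]; rewrite !in_itv/= => /andP[_ yb] /andP[].
  by rewrite ltNge yb.
Qed.

Lemma le_lebesgue_integral (m a b : R) : a <= b -> (forall x, m <= f x) ->
  m * (b - a) <= lebesgue_integral a b f.
Proof.
move=> ab f_ge.
have -> : m * (b - a) = Rintegral (@completed_lebesgue_measure R) `[a, b] (cst m).
  rewrite Rintegral_cst; last exact: measurable_lebesgueType_itv.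
  by rewrite [X in fine X](completed_lebesgue_measure_itv ab).
apply: le_Rintegral => //.
- exact: measurable_lebesgueType_itv.
- exact: (@bounded_integrable_itv _ _ _ _ `|m|).
Qed.

Lemma primitive0B (s t : R) : s <= t ->
  primitive0 f t - primitive0 f s = lebesgue_integral s t f.
Proof.
move=> st; rewrite /primitive0; case: (leP 0 s) => s0; case: (leP 0 t) => t0.
- by rewrite (@lebesgue_integralD 0 s t) // addrC addKr.
- by have := le_lt_trans st t0; rewrite ltNge s0.
- by rewrite opprK addrC -lebesgue_integralD // ltW.
- by rewrite opprK addrC (@lebesgue_integralD s t 0) ?addrK // ltW.
Qed.

Lemma primitive0_inj (m : R) : 0 < m -> (forall x, m <= f x) ->
  injective (primitive0 f).
Proof.
move=> m0 f_ge.
have incr s t : s < t -> primitive0 f s < primitive0 f t.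
  move=> st; rewrite -subr_gt0 primitive0B ?ltW //.
  apply: lt_le_trans (le_lebesgue_integral (ltW st) f_ge).
  by rewrite mulr_gt0 // subr_gt0.
move=> s t est; case: (ltgtP s t) => // /incr; by rewrite est ltxx.
Qed.

(** Periodicity lets the integral between 0 and [t] be moved to the interval between [T] and
    [t + T], so the increment of the primitive is the same on both; its value at [T] is the integral
    over a period. *)
Lemma primitive0D_period (T t : R) : 0 <= T -> (forall x, 0 <= f x) ->
  periodic f T ->
  primitive0 f (t + T) = primitive0 f t + lebesgue_integral 0 T f.
Proof.
move=> T0 f0 perf.
have shiftT a b : lebesgue_integral a b f = lebesgue_integral (a + T) (b + T) f.
  rewrite -lebesgue_integral_shift //; congr lebesgue_integral.
  by apply/funext => x; rewrite perf.
have p00 : primitive0 f 0 = 0.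
  have := @primitive0B 0 0 (lexx _); rewrite subrr => e.
  by rewrite /primitive0 lexx -e.
have pT : lebesgue_integral 0 T f = primitive0 f T by rewrite /primitive0 T0.
rewrite pT; have [t0|/ltW t0] := leP 0 t.
  have := primitive0B t0.
  by rewrite shiftT add0r -primitive0B ?lerDr // p00 subr0 => ->; rewrite subrK.
have := primitive0B t0.
rewrite shiftT add0r -primitive0B ?gerDr // p00 sub0r => e.
by rewrite -[primitive0 f t]opprK e opprB subrK.
Qed.

(** Subtracting the integral over a period from V t gives V (t - T), a value of V, where injectivity
    cancels the inverse. *)
Lemma entry_time_period (m T t : R) : 0 <= T -> 0 < m ->
  (forall x, m <= f x) -> periodic f T ->
  entry_time f (lebesgue_integral 0 T f) t = t - T.
Proof.
move=> T0 m0 f_ge perf; rewrite /entry_time.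
rewrite -{1}(subrK T t) primitive0D_period //; last first.
  by move=> x; apply: le_trans (ltW m0) (f_ge x).
rewrite addrK pinvKV ?inE // => x y _ _; exact: (primitive0_inj m0 f_ge).
Qed.

End bounded_integrand.

(** * Monotonicity and concavity of [Psi] *)

Lemma concave_of_derive (R : realType) (f df : R -> R) :
  (forall x : R, 0 < x -> is_derive x 1 f (df x)) ->
  (forall x y, 0 < x -> x <= y -> df y <= df x) ->
  concave_function `]0, +oo[ f.
Proof.
move=> fdf dfle.
have mvt a b : 0 < a -> a <= b ->
    exists2 c, a <= c <= b & f b - f a = df c * (b - a).
  move=> a0 ab.
  have [||c] := @MVT_segment R f df a b ab.
  - by move=> x; rewrite in_itv/= => /andP[ax _]; apply: fdf; exact: lt_trans ax.
  - apply: derivable_within_continuous => x; rewrite in_itv/= => /andP[ax _].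
    by have [] := fdf x (lt_le_trans a0 ax).
  - by rewrite in_itv/= => acb e; exists c.
(* For ordered endpoints, the mean value theorem on [x, z] and [z, y] turns the concavity gap into s
   (1 - s) (y - x) (df c - df d) with c <= d. *)
have half (s : R) x y : 0 <= s <= 1 -> 0 < x -> x <= y ->
    s * f x + (1 - s) * f y <= f (s * x + (1 - s) * y).
  move=> /andP[s0 s1] x0 xy; set z := s * x + _.
  have zx : z - x = (1 - s) * (y - x) by rewrite /z; ring.
  have yz : y - z = s * (y - x) by rewrite /z; ring.
  have xz : x <= z by rewrite -subr_ge0 zx mulr_ge0 ?subr_ge0.
  have zy : z <= y by rewrite -subr_ge0 yz mulr_ge0 ?subr_ge0.
  have [c /andP[xc cz] ec] := mvt x z x0 xz.
  have [d /andP[zd dy] ed] := mvt z y (lt_le_trans x0 xz) zy.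
  have dcd : df d <= df c.
    by apply: dfle; [exact: lt_le_trans xc|exact: le_trans zd].
  rewrite -subr_ge0.
  have -> : f z - (s * f x + (1 - s) * f y) =
      s * (f z - f x) - (1 - s) * (f y - f z) by ring.
  rewrite ec ed zx yz.
  have -> : s * (df c * ((1 - s) * (y - x))) - (1 - s) * (df d * (s * (y - x))) =
     s * (1 - s) * (y - x) * (df c - df d) by ring.
  by rewrite !mulr_ge0 ?subr_ge0.
move=> t x y; rewrite !inE /= !in_itv /= !andbT => x0 y0.
rewrite !convRE -lerN2 opprD -!mulrN !opprK.
have t01 : 0 <= t%:num <= 1 by apply/andP; split.
have [xy|/ltW yx] := leP x y; first exact: half.
(* For y <= x the endpoints are exchanged, and so are the weights. *)
have := half (1 - t%:num) y x.
rewrite subKr ![(1 - _) * _ + _]addrC; apply=> //.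
by rewrite subr_ge0 gerBl; apply/andP; split.
Qed.

Section Psi_derivative.
Variables (R : realType) (k n tau : R).
Hypotheses (k0 : 0 < k) (tau0 : 0 < tau) (n1 : 1 < n).

Let K := k * (n - 1) * tau.
Let dPsi (x : R) := (1 + K * x `^ (n - 1)) `^ (- (n - 1)^-1 - 1).

Let m0 : 0 < n - 1. Proof. by rewrite subr_gt0. Qed.
Let K0 : 0 < K. Proof. by rewrite /K !mulr_gt0. Qed.

(** The chain rule yields a product of two powers; merging them into one power of 1 + K x^m makes
    sign and monotonicity visible. *)
Lemma is_derive_Psi (x : R) : 0 < x ->
  is_derive x 1 (Psi k n tau)
    ((1 + k * (n - 1) * tau * x `^ (n - 1)) `^ (- (n - 1)^-1 - 1)).
Proof.
move=> x0; rewrite -/K.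
have u0 : 0 < x `^ (- (n - 1)) + K by rewrite addr_gt0 // powR_gt0.
have du : is_derive x 1 (fun y => y `^ (- (n - 1)) + K)
    (- (n - 1) * x `^ (- (n - 1) - 1)).
  by have := is_deriveD (is_derive1_powR (- (n - 1)) x0) (is_derive_cst K x (1 : R));
    rewrite addr0.
have := @is_derive1_comp R (@powR R ^~ (- (n - 1)^-1))
  (fun y => y `^ (- (n - 1)) + K) _ _ _ (is_derive1_powR _ u0) du.
have -> : - (n - 1)^-1 * (x `^ (- (n - 1)) + K) `^ (- (n - 1)^-1 - 1) *
    (- (n - 1) * x `^ (- (n - 1) - 1)) = dPsi x; last by [].
rewrite mulrACA mulrNN mulVf ?gt_eqF // mul1r.
(* Both factors become powers of the same exponent, so they merge into
   a power of [(x^-m + K) * x^m = 1 + K x^m]. *)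
have -> : x `^ (- (n - 1) - 1) = (x `^ (n - 1)) `^ (- (n - 1)^-1 - 1).
  rewrite -powRrM; congr (_ `^ _).
  by rewrite mulrBr mulrN mulfV ?gt_eqF // mulr1 addrC.
rewrite -powRM ?powR_ge0 ?ltW // mulrDl -powRD ?addNr ?powRr0 //.
(* The merged exponents -m and m sum to zero, which requires the base x to be nonzero. *)
by rewrite eqxx gt_eqF.
Qed.

Lemma Psi_increasing : {in `]0, +oo[ &, {homo Psi k n tau : x y / x < y}}.
Proof.
move=> x y; rewrite !in_itv/= !andbT => x0 y0 xy.
have [||c _ e] := @MVT R (Psi k n tau) dPsi x y xy.
- move=> z; rewrite in_itv/= => /andP[xz _].
  by apply: is_derive_Psi; exact: lt_trans xz.
- apply: derivable_within_continuous => z; rewrite in_itv/= => /andP[xz _].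
  by have [] := is_derive_Psi (lt_le_trans x0 xz).
- rewrite -subr_gt0 e mulr_gt0 ?subr_gt0 //.
  by rewrite powR_gt0 // ltr_wpDr // mulr_ge0 ?powR_ge0 // ltW.
Qed.

Lemma Psi_concave : concave_function `]0, +oo[ (Psi k n tau).
Proof.
apply: concave_of_derive is_derive_Psi _ => x y x0 xy.
have b1 z : 0 < 1 + K * z `^ (n - 1).
  by rewrite ltr_wpDr // mulr_ge0 ?powR_ge0 // ltW.
(* The exponent is negative; as the inverse of an increasing positive power, the derivative is seen
   to decrease. *)
have dPsiE z : dPsi z = ((1 + K * z `^ (n - 1)) `^ ((n - 1)^-1 + 1))^-1.
  by rewrite -powRN opprD.
have p0 : 0 <= (n - 1)^-1 + 1 by rewrite addr_ge0 // invr_ge0 ltW.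
have le_pow : x `^ (n - 1) <= y `^ (n - 1).
  by apply: (ge0_ler_powR (ltW m0)) => //; rewrite nnegrE ltW // (lt_le_trans x0 xy).
have le_base : 1 + K * x `^ (n - 1) <= 1 + K * y `^ (n - 1).
  by rewrite lerD2l ler_pM2l.
change (dPsi y <= dPsi x); rewrite !dPsiE.
rewrite lef_pV2; [|by rewrite posrE powR_gt0..].
by apply: (ge0_ler_powR p0) => //; rewrite nnegrE ltW.
Qed.

End Psi_derivative.

(** * The outlet concentration and the cost *)

Lemma admissible_C_A_outlet (R : realType)
    (k n tau Cmin Cmax vmin vmax L Cbar vbar : R) (cA0 v : R -> R) (t : R) :
  0 < tau -> 0 < vmin ->
  admissible tau Cmin Cmax vmin vmax L Cbar vbar cA0 v ->
  C_A k n cA0 v L t =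
  if n == 1 then cA0 t * expR (- k * tau) else Psi k n tau (cA0 t).
Proof.
(* The flow condition replaces [L] by the integral of [v] over a period, the form in which the entry
   time is known. *)
move=> tau0 vmin0 [mc mv perc perv rc rv _ <-].
have v_le x : `|v x| <= vmax.
  have /andP[vx xv] := rv x.
  by rewrite ger0_norm // (le_trans (ltW vmin0) vx).
rewrite /C_A (entry_time_period mv v_le t (ltW tau0) vmin0) //; last first.
  by move=> x; case/andP: (rv x).
by rewrite -[in RHS](subrK tau t) perc subKr.
Qed.

Theorem lemma3p3 (R : realType) (k n tau Cmin Cmax vmin vmax L Cbar vbar : R)
    (cA0 v : R -> R) :
  0 < k -> 0 < n -> 0 < tau ->
  0 < Cmin -> Cmin < Cmax -> 0 < vmin -> vmin < vmax ->
  vmin * tau <= L <= vmax * tau ->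
  Cmin <= Cbar <= Cmax -> vmin <= vbar <= vmax ->
  admissible tau Cmin Cmax vmin vmax L Cbar vbar cA0 v ->
  [/\ n = 1 ->
        cost k n tau L cA0 v =
        tau^-1 * lebesgue_integral 0 tau
                   (fun t => cA0 t * expR (- k * tau) * v t),
      n <> 1 ->
        cost k n tau L cA0 v =
        tau^-1 * lebesgue_integral 0 tau (fun t => Psi k n tau (cA0 t) * v t)
    & 1 < n ->
        {in `]0, +oo[ &, {homo Psi k n tau : x y / x < y}} /\
        concave_function `]0, +oo[ (Psi k n tau)].
Proof.
move=> k0 _ tau0 _ _ vmin0 _ _ _ _ adm; split=> [n1|/eqP n1|n1].
(* The outlet formula holds at every real time, so the integrands are equal as functions. *)
- congr (_ * lebesgue_integral _ _ _); apply/funext => t.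
  by rewrite (admissible_C_A_outlet k n t tau0 vmin0 adm) n1 eqxx.
- congr (_ * lebesgue_integral _ _ _); apply/funext => t.
  by rewrite (admissible_C_A_outlet k n t tau0 vmin0 adm) (negbTE n1).
- by split; [exact: Psi_increasing|exact: Psi_concave].
Qed.
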